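(* Let $A$ be a commutative ring and let $X_\bullet$ be any simplicial $A$-module. For every degree $p\ge1$ and every $j\in\{0,\dots,p\}$, $$R_{p,j}(X)\cap D_p(X)=\{0\}.$$
   Context: For a simplicial $A$-module $X_\bullet$ with face maps $d_i:X_p\to X_{p-1}$ and degeneracy maps $s_r:X_{p-1}\to X_p$: the horn kernel is $R_{p,j}(X)=\bigcap_{0\le i\le p,\ i\ne j}\ker(d_i:X_p\to X_{p-1})$, and the degenerate submodule is $D_p(X)=\sum_{r=0}^{p-1}\operatorname{im}(s_r:X_{p-1}\to X_p)$. *)

(* Defs.v *)
From HB Require Import structures.
From mathcomp Require Import all_boot all_order all_algebra.
From mathcomp Require Import classical_sets.

Set Implicit Arguments.
Unset Strict Implicit.
Unset Printing Implicit Defensive.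

Import GRing.Theory.

Local Open Scope classical_set_scope.
Local Open Scope ring_scope.

(* The simplicial identities quantify over natural numbers in the ranges where
   every index is admissible, so each [inord k] below is the ordinal of value
   k. The base ring may be the zero ring. *)
Record simplicial_module (A : comPzRingType) := SimplicialModule {
  smod :> nat -> lmodType A;
  face : forall p : nat, 'I_p.+2 -> {linear smod p.+1 -> smod p};
  degen : forall p : nat, 'I_p.+1 -> {linear smod p -> smod p.+1};
  face_face : forall (p i j : nat) (x : smod p.+2), (i < j <= p.+2)%N ->
    face (inord i) (face (inord j) x) = face (inord j.-1) (face (inord i) x);
  degen_degen : forall (p i j : nat) (x : smod p), (i <= j <= p)%N ->
    degen (inord i) (degen (inord j) x) = degen (inord j.+1) (degen (inord i) x);
  face_degen_lt : forall (p i j : nat) (x : smod p.+1), (i < j <= p.+1)%N ->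
    face (inord i) (degen (inord j) x) = degen (inord j.-1) (face (inord i) x);
  face_degen_id : forall (p j : nat) (x : smod p), (j <= p)%N ->
    face (inord j) (degen (inord j) x) = x;
  face_degen_idS : forall (p j : nat) (x : smod p), (j <= p)%N ->
    face (inord j.+1) (degen (inord j) x) = x;
  face_degen_gt : forall (p i j : nat) (x : smod p.+1), (j.+1 < i <= p.+2)%N ->
    face (inord i) (degen (inord j) x) = degen (inord j) (face (inord i.-1) x)
}.

(* Degrees p >= 1 are written p.+1: [horn_kernel X p j] is R_{p+1,j}(X) and
   [degenerate X p] is D_{p+1}(X), both inside X_{p+1}. *)
Definition horn_kernel (A : comPzRingType) (X : simplicial_module A)
    (p : nat) (j : 'I_p.+2) : set (X p.+1) :=
  \bigcap_(i in [set i : 'I_p.+2 | i != j]) [set x | face X i x = 0].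

Definition degenerate (A : comPzRingType) (X : simplicial_module A)
    (p : nat) : set (X p.+1) :=
  [set \sum_(r < p.+1) degen X r (y r) | y in [set: 'I_p.+1 -> X p]].

Arguments horn_kernel {A} X p j.
Arguments degenerate {A} X p.

(* Main.v *)
(** For [x] in the horn kernel at [j], every operator [1 - s_k d_f] with [f != j]
    fixes [x].  Taking [f = k] or [f = k + 1], it kills the image of [s_k], and it
    preserves the image of each other [s_r], except that of [s_(k-1)] when
    [f = k] and that of [s_(k+1)] when [f = k + 1].  Hence one can remove the
    terms of [x = \sum_r s_r y_r] one at a time: first [k = 0, ..., j - 1] in
    increasing order with [f = k], then [k = p, ..., j] in decreasing order with
    [f = k + 1]; the troublesome neighbour has always been removed already. *)
Require Import Defs.
From mathcomp Require Import all_boot all_order all_algebra.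
From mathcomp Require Import classical_sets.
From mathcomp Require Import zify.

Import GRing.Theory.

Local Open Scope classical_set_scope.
Local Open Scope ring_scope.

Definition degen_span {A : comPzRingType} (X : simplicial_module A) (p : nat)
    (P : pred 'I_p.+1) : set (X p.+1) :=
  [set x | exists y : 'I_p.+1 -> X p, x = \sum_(r | P r) degen X r (y r)].

Lemma eq_degen_span (A : comPzRingType) (X : simplicial_module A) (p : nat)
    (P Q : pred 'I_p.+1) : P =1 Q -> degen_span X p P `<=` degen_span X p Q.
Proof. by move=> PQ x [y ->]; exists y; apply: eq_bigl. Qed.

(** Move [d_f] past [s_r], then swap the two degeneracies: [s_k s_r = s_r s_(k-1)] if [r < k], and
    [s_k s_(r-1) = s_r s_k] if [k < r]. *)
Lemma degen_face_degen (A : comPzRingType) (X : simplicial_module A) (p : nat)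
    (k r : 'I_p.+1) (f : 'I_p.+2) (y : X p) :
  (r < k)%N && (r.+1 < f)%N || (k < r)%N && (f < r)%N ->
  exists z, degen X k (face X f (degen X r y)) = degen X r z.
Proof.
case: p k r f y => [|p] k r f y.
  (* Here [k = r = 0], against the hypothesis. *)
  by rewrite (ord1 k) (ord1 r).
move: (ltn_ord k) (ltn_ord r) (ltn_ord f) => kp rp fp.
rewrite -(inord_val k) -(inord_val r) -(inord_val f) !inordK //.
case/orP=> /andP[h1 h2].
- exists (degen X (inord k.-1) (face X (inord f.-1) y)).
  rewrite face_degen_gt; last by lia.
  by rewrite [RHS]degen_degen ?prednK //; lia.
- exists (degen X (inord k) (face X (inord f) y)).
  rewrite face_degen_lt; last by lia.
  by rewrite [LHS]degen_degen ?prednK //; lia.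
Qed.

(** The condition on [P] excludes exactly the troublesome neighbour: [k - 1] if [f = k], [k + 1] if
    [f = k + 1]. *)
Lemma degen_span_remove (A : comPzRingType) (X : simplicial_module A) (p : nat)
    (P : pred 'I_p.+1) (k : 'I_p.+1) (f : 'I_p.+2) (x : X p.+1) :
  (f == k :> nat) || (f == k.+1 :> nat) ->
  (forall r, P r -> r != k ->
     (r < k)%N && (r.+1 < f)%N || (k < r)%N && (f < r)%N) ->
  face X f x = 0 -> degen_span X p P x ->
  degen_span X p (fun r => P r && (r != k)) x.
Proof.
move=> fk hP fx [y xE].
have fkid w : face X f (degen X k w) = w.
  rewrite -(inord_val f) -(inord_val k).
  by case/orP: fk => /eqP ->; [apply: face_degen_id | apply: face_degen_idS];
    rewrite -ltnS.
have /fin_all_exists[z zE] (r : 'I_p.+1) : exists z, P r -> r != k ->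
    degen X k (face X f (degen X r (y r))) = degen X r z.
  have [Pr|_] := boolP (P r); last by exists 0.
  have [_|rk] := eqVneq r k; first by exists 0.
  by have [z zE] := degen_face_degen A X p k r f (y r) (hP r Pr rk); exists z.
(* [1 - s_k d_f] sends [s_r y_r] to [s_r (y_r - z_r)] for [r != k], and [s_k y_k] to 0. *)
exists (fun r => y r - z r).
have -> : x = x - degen X k (face X f x) by rewrite fx linear0 subr0.
rewrite xE !linear_sum -big_split /= (bigID (fun r => r == k)) /=.
rewrite big1 ?add0r => [|r /andP[_ /eqP ->]]; last by rewrite fkid subrr.
by apply: eq_bigr => r /andP[Pr rk]; rewrite linearB zE.
Qed.

Theorem lemma6p1 (A : comPzRingType) (X : simplicial_module A)
    (p : nat) (j : 'I_p.+2) :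
  horn_kernel X p j `&` degenerate X p = [set 0].
Proof.
apply/seteqP; split=> [x [Rx [y _ yx]]|x ->]; last first.
  split; first by move=> i _ /=; rewrite linear0.
  by exists (fun=> 0) => //; rewrite big1 // => r _; rewrite linear0.
have fx f : f != j -> face X f x = 0 by move=> fj; apply: Rx.
have jp := ltn_ord j.
have low n : (n <= j)%N -> degen_span X p (fun r => n <= r)%N x.
  elim: n => [|n IHn] nj; first by exists y.
  have np : (n < p.+1)%N by lia.
  (* The face index is [f = n < j]. *)
  have nfj : widen_ord (leqnSn _) (Ordinal np) != j by rewrite -val_eqE /=; lia.
  apply: eq_degen_span (degen_span_remove A X p _ (Ordinal np) _ x _ _
    (fx _ nfj) (IHn (ltnW nj))) => [r||r] /=; rewrite -?val_eqE /=; lia.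
have high n : (n <= p.+1 - j)%N ->
    degen_span X p (fun r => (j <= r) && (r < p.+1 - n))%N x.
  elim: n => [|n IHn] nj.
    by apply: eq_degen_span (low j (leqnn j)) => r; have := ltn_ord r; lia.
  have np : (p - n < p.+1)%N by lia.
  (* Now [k = p - n >= j], and [lift ord0] gives [f = k + 1 > j]. *)
  have nfj : lift ord0 (Ordinal np) != j.
    by rewrite -val_eqE /= /bump /=; lia.
  apply: eq_degen_span (degen_span_remove A X p _ (Ordinal np) _ x _ _
    (fx _ nfj) (IHn (ltnW nj))) => [r||r] /=;
    rewrite -?val_eqE /= ?/bump /=; lia.
(* At [n = p + 1 - j] the range [j <= r < j] is empty. *)
have [z ->] := high _ (leqnn _).
by rewrite big_pred0 // => r; lia.
Qed.
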